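(* Let $F$ be a 2-CNF formula, $L$ a set of literals such that $SWRT(F,\neg L)$ is true, and $l_y$ a literal with $Var(l_y)\notin Var(L)$. Let $D$ be the implication graph of $F$. Then: (1) the largest number $MaxPaths(F,L,l_y)$ of pairwise clause-disjoint paths of $F$ from $L$ to $l_y$ equals the largest number of pairwise arc-disjoint paths of $D$ from $\neg L$ to $l_y$; (2) $SepSize(F,L,l_y)=ArcSepSize(D,\neg L,l_y)$; (3) $MaxPaths(F,L,l_y)=SepSize(F,L,l_y)$.
   Context: A literal is a Boolean variable or its negation; $\neg$ denotes negation, and for a set $L$ of literals $\neg L=\{\neg l': l'\in L\}$. $Var(\cdot)$ denotes the set of variables. A 2-CNF formula $F$ is a conjunction of clauses each consisting of exactly two literals (a one-literal clause $(l)$ is written $(l\vee l)$; $(l_1\vee l_2)$ and $(l_2\vee l_1)$ are the same clause), with pairwise distinct clauses; $F\setminus S$ denotes the formula of clauses of $F$ not in the set $S$. A set of literals is non-contradictory if it contains no literal and its negation. A satisfying assignment of $F$ is a non-contradictory set $P$ of literals with $Var(P)=Var(F)$ such that each clause of $F$ contains a literal of $P$. $SWRT(F,M)$ means $F$ has a satisfying assignment $P$ with $P\cap \neg M=\emptyset$. A walk of $F$ is a nonempty sequence $(C_1,\dots,C_q)$ of (not necessarily distinct) clauses of $F$ where in each entry one literal is designated first and the other second, such that for $i<q$ the second literal of $C_i$ is the negation of the first literal of $C_{i+1}$; it is from the first literal of $C_1$ to the second literal of $C_q$, and from a set $M$ if its first literal lies in $M$. A path of $F$ is a walk whose clauses are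 pairwise distinct; paths are clause-disjoint if no clause occurs in two of them. A separator of $F$ w.r.t. a set of literals $M$ and literal $l_y$ is a set $SC$ of clauses of $F$ such that $F\setminus SC$ has no path from $M$ to $l_y$; $SepSize(F,M,l_y)$ is its minimum size. The implication graph $D$ of $F$ is the digraph whose vertices are the literals of the variables of $F$, with an arc $(l_1,l_2)$ iff $(\neg l_1\vee l_2)$ is a clause of $F$. Paths in $D$ are directed paths (no repeated vertices) with at least one arc, and a path from a vertex set $M$ starts at a vertex of $M$. An arc separator of $D$ w.r.t. $M$ and $l_y$ is a set of arcs whose removal leaves no path from $M$ to $l_y$; $ArcSepSize(D,M,l_y)$ is its minimum size. *)

(* Defs.v *)
From HB Require Import structures.
From mathcomp Require Import all_boot.
From mathcomp Require Import boolp.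

Set Implicit Arguments.
Unset Strict Implicit.
Unset Printing Implicit Defensive.

(* (x, true) is the positive literal of the variable x, (x, false) its
   negation. *)
Definition lit (V : finType) : Type := (V * bool)%type.
HB.instance Definition _ (V : finType) := Finite.copy (lit V) (V * bool)%type.

Definition pairwise_disjoint (X : eqType) (ss : seq (seq X)) : bool :=
  pairwise (fun s t => ~~ has (mem s) t) ss.

Lemma pairwise_disjoint_size (X : finType) (A : {set X}) (ss : seq (seq X)) :
    (forall s, s \in ss -> s != [::] /\ {subset s <= A}) ->
  pairwise_disjoint ss -> size ss <= #|A|.
Proof.
move=> ssA dss.
have [hd [hds hdu hdss]] : exists hd : seq X, [/\ size hd = size ss, uniq hd
    & forall x, x \in hd -> exists2 s, s \in ss & x \in s].
  elim: ss ssA dss => [|s ss IH] ssA /=; first by exists [::].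
  rewrite /pairwise_disjoint /= => /andP[/allP ds dss].
  have [t tss|hd [hds hdu hdss]] := IH _ dss.
    by apply: ssA; rewrite inE tss orbT.
  have [s0 _] := ssA s (mem_head _ _).
  case: s s0 ds {ssA} => // x s _ ds.
  exists (x :: hd); split => /=; first by rewrite hds.
    rewrite hdu andbT; apply/negP => /hdss[t tss xt].
    by move/hasP: (ds _ tss); apply; exists x => //; rewrite /= inE eqxx.
  move=> y; rewrite inE => /predU1P[->|/hdss[t tss yt]].
    by exists (x :: s); rewrite ?mem_head.
  by exists t => //; rewrite inE tss orbT.
rewrite -hds -(card_uniqP hdu); apply/subset_leq_card/subsetP => x.
by case/hdss => s /ssA[_ sA] /sA.
Qed.

Section TwoCNF.
Variable V : finType.
Implicit Types (l : lit V) (L M P : {set lit V}) (F SC : {set {set lit V}}).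

Definition var l : V := l.1.
Definition neg l : lit V := (l.1, ~~ l.2).
Definition negs L : {set lit V} := [set neg l | l in L].
Definition lit_vars L : {set V} := [set var l | l in L].
Definition cnf_vars F : {set V} := lit_vars (cover F).

(* (l1 \/ l2) is the unordered pair [set l1; l2]; the one-literal clause
   (l \/ l) is the singleton [set l; l] = [set l]. *)
Definition is_2cnf F : Prop :=
  forall C, C \in F -> exists l1 l2, C = [set l1; l2].

Definition noncontradictory P : Prop := forall l, l \in P -> neg l \notin P.

Definition satisfying F P : Prop :=
  [/\ noncontradictory P, lit_vars P = cnf_vars F
    & forall C, C \in F -> exists2 l, l \in C & l \in P].

Definition SWRT F M : Prop :=
  exists2 P, satisfying F P & P :&: negs M = set0.

(* An entry of a walk is the pair (first literal, second literal). *)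
Definition entry : Type := (lit V * lit V)%type.
Definition entry_clause (e : entry) : {set lit V} := [set e.1; e.2].
Definition walk_clauses (w : seq entry) : seq {set lit V} :=
  map entry_clause w.

Definition is_walk F (w : seq entry) : bool :=
  [&& w != [::], all (fun e => entry_clause e \in F) w
    & sorted (fun e e' => e.2 == neg e'.1) w].

Definition is_path F (w : seq entry) : bool :=
  is_walk F w && uniq (walk_clauses w).

Definition walk_from_to M l (w : seq entry) : bool :=
  if w is e :: w' then (e.1 \in M) && ((last e w').2 == l) else false.

Definition clause_disjoint_paths F M l (n : nat) : Prop :=
  exists ps : seq (seq entry),
    [/\ size ps = n,
        forall w, w \in ps -> is_path F w && walk_from_to M l w
      & pairwise_disjoint (map walk_clauses ps)].

Definition is_separator F M l SC : Prop :=
  SC \subset F /\ ~ exists w, is_path (F :\: SC) w && walk_from_to M l w.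

Definition separator_of_size F M l (n : nat) : Prop :=
  exists2 SC, is_separator F M l SC & #|SC| = n.

Lemma clause_disjoint_paths_ex F M l :
  exists n, `[< clause_disjoint_paths F M l n >].
Proof. by exists 0; apply/asboolP; exists [::]; split. Qed.

Lemma clause_disjoint_paths_ub F M l n :
  `[< clause_disjoint_paths F M l n >] -> n <= #|F|.
Proof.
move=> /asboolP[ps [<- psF dps]]; rewrite -(size_map walk_clauses).
apply: pairwise_disjoint_size dps => _ /mapP[w /psF wF ->].
move: wF => /andP[/andP[/and3P[w0 /allP wF _] _] _]; split; first by case: w w0 wF.
by move=> _ /mapP[e /wF eF ->].
Qed.

Lemma separator_of_size_ex F M l : exists n, `[< separator_of_size F M l n >].
Proof.
exists #|F|; apply/asboolP; exists F => //; split => //.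
move=> [[|e w] /andP[/andP[/and3P[//= _ /andP[]]]]].
by rewrite setDv inE.
Qed.

Definition MaxPaths F M l : nat :=
  ex_maxn (clause_disjoint_paths_ex F M l) (@clause_disjoint_paths_ub F M l).

Definition SepSize F M l : nat := ex_minn (separator_of_size_ex F M l).

End TwoCNF.

Record digraph (T : finType) := Digraph {
  vertices : {set T};
  arcs : {set T * T}
}.

Section Digraph.
Variable T : finType.
Implicit Types (D : digraph T) (M : {set T}) (S : {set T * T}) (y : T).

Definition remove_arcs D S : digraph T := Digraph (vertices D) (arcs D :\: S).

(* A directed path is given by the sequence of its vertices. *)
Definition is_dpath D (p : seq T) : bool :=
  [&& 1 < size p, uniq p, all (mem (vertices D)) p
    & sorted (fun x y => (x, y) \in arcs D) p].

Definition dpath_arcs (p : seq T) : seq (T * T) := zip p (behead p).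

Definition dpath_from_to M y (p : seq T) : bool :=
  if p is x :: p' then (x \in M) && (last x p' == y) else false.

Definition arc_disjoint_paths D M y (n : nat) : Prop :=
  exists ps : seq (seq T),
    [/\ size ps = n,
        forall p, p \in ps -> is_dpath D p && dpath_from_to M y p
      & pairwise_disjoint (map dpath_arcs ps)].

Definition is_arc_separator D M y S : Prop :=
  S \subset arcs D /\
  ~ exists p, is_dpath (remove_arcs D S) p && dpath_from_to M y p.

Definition arc_separator_of_size D M y (n : nat) : Prop :=
  exists2 S, is_arc_separator D M y S & #|S| = n.

Lemma arc_disjoint_paths_ex D M y :
  exists n, `[< arc_disjoint_paths D M y n >].
Proof. by exists 0; apply/asboolP; exists [::]; split. Qed.

Lemma arc_disjoint_paths_ub D M y n :
  `[< arc_disjoint_paths D M y n >] -> n <= #|arcs D|.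
Proof.
move=> /asboolP[ps [<- psD dps]]; rewrite -(size_map dpath_arcs).
apply: pairwise_disjoint_size dps => _ /mapP[p /psD pD ->].
move: pD => /andP[/and4P[p2 _ _ pD] _].
case: p p2 pD => [//|x [//|x' p]] _ pD; split => // a.
rewrite /dpath_arcs /=; elim: p x x' pD => [|z p IH] x x' /=.
  by rewrite andbT inE => xx' /eqP->.
by move=> /andP[xx' x'p]; rewrite inE => /predU1P[->//|]; apply: IH.
Qed.

Lemma arc_separator_of_size_ex D M y :
  exists n, `[< arc_separator_of_size D M y n >].
Proof.
exists #|arcs D|; apply/asboolP; exists (arcs D) => //; split => //.
move=> [[|x [|x' p]] /andP[/and4P[//= _ _ _ /andP[]]]].
by rewrite setDv inE.
Qed.

Definition MaxArcPaths D M y : nat :=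
  ex_maxn (arc_disjoint_paths_ex D M y) (@arc_disjoint_paths_ub D M y).

Definition ArcSepSize D M y : nat := ex_minn (arc_separator_of_size_ex D M y).

End Digraph.

Definition implication_graph (V : finType) (F : {set {set lit V}}) :
    digraph (lit V) :=
  Digraph [set l : lit V | var l \in cnf_vars F]
          [set a : lit V * lit V | [set neg a.1; a.2] \in F].

(* Main.v *)
Require Import Defs.
From mathcomp Require Import all_boot all_algebra.
From mathcomp Require Import boolp zify.

Set Implicit Arguments.
Unset Strict Implicit.
Unset Printing Implicit Defensive.

Import GRing.Theory.

(** Fix an assignment [P] satisfying [F] and avoiding [L].  A path of the
    implication graph that starts in [negs L] starts in [P], hence stays in
    [P], and an arc joining two literals of [P] is determined by its clause; so
    arc-disjoint paths of the implication graph yield clause-disjoint paths of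
    [F].  The four quantities are therefore equal, being squeezed by
    [ArcSepSize = MaxArcPaths <= MaxPaths <= SepSize <= ArcSepSize]: the
    equality is the arc version of Menger's theorem, proved by augmenting 0/1
    flows along residual paths, [MaxPaths <= SepSize] is weak duality, and the
    last inequality holds because a walk of [F] shortens to a simple path of
    the implication graph. *)

Lemma all_setD (X : finType) (A B : {set X}) (s : seq X) :
  all (mem (A :\: B)) s = all (mem A) s && ~~ has (mem B) s.
Proof.
by rewrite -all_predC -all_predI; apply: eq_all => x; rewrite /= inE andbC.
Qed.

Lemma pairwise_disjoint_hitting_size (X : finType) (A : {set X})
    (ss : seq (seq X)) :
  (forall s, s \in ss -> has (mem A) s) -> pairwise_disjoint ss ->
  size ss <= #|A|.
Proof.
move=> ssA dss; pose trace (s : seq X) := filter (mem A) s.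
rewrite -(size_map trace); apply: pairwise_disjoint_size.
  move=> _ /mapP[s /ssA sA ->]; split; last by apply/allP/filter_all.
  by rewrite -size_eq0 size_filter -lt0n -has_count.
rewrite /pairwise_disjoint pairwise_map; apply: sub_pairwise dss => s t.
apply: contra => /hasP[x]; rewrite /= !mem_filter => /andP[_ xt] /andP[_ xs].
by apply/hasP; exists x.
Qed.

Lemma pairwise_disjoint_map (X Y : eqType) (f : X -> Y) (A : {pred X})
    (ss : seq (seq X)) :
  {in A &, injective f} -> (forall s, s \in ss -> {subset s <= A}) ->
  pairwise_disjoint ss -> pairwise_disjoint (map (map f) ss).
Proof.
move=> f_inj ssA; rewrite /pairwise_disjoint pairwise_map.
apply: (@sub_in_pairwise _ (mem ss)); last exact/allP.
move=> s t /ssA sA /ssA tA; apply: contra => /hasP[_ /mapP[x xt ->]].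
move=> /mapP[y ys fxy]; apply/hasP; exists x => //=.
by rewrite (f_inj _ _ (tA _ xt) (sA _ ys) fxy).
Qed.

Section VertexSequences.
Variable T : finType.
Implicit Types (x y : T) (p : seq T) (M : {set T}) (S : {set T * T}).

Lemma path_dpath_arcs S x p :
  path (fun u v => (u, v) \in S) x p = all (mem S) (dpath_arcs (x :: p)).
Proof. by elim: p x => //= z p IH x; rewrite IH. Qed.

Lemma dpath_from_toD1 M y p : uniq p ->
  dpath_from_to (M :\ y) y p = (1 < size p) && dpath_from_to M y p.
Proof.
case: p => [|x [|z p]] //=.
  by rewrite !inE; case: (x == y); rewrite ?andbF.
move=> /andP[x_zp _]; rewrite !inE.
have last_x : (last z p == x) = false.
  by apply: contraNF x_zp => /eqP<-; apply: mem_last.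
by have [<-|//] := eqVneq x y; rewrite last_x !andbF.
Qed.

Definition simple_path S M y p : bool :=
  [&& uniq p, dpath_from_to M y p & all (mem S) (dpath_arcs p)].

Lemma shorten_simple_path S M y p :
    dpath_from_to M y p -> all (mem S) (dpath_arcs p) ->
  exists q, simple_path S M y q.
Proof.
case: p => [//|x p] /= /andP[xM /eqP lastp]; rewrite -path_dpath_arcs => xp.
case/shortenP: xp lastp => q xq q_uniq _ lastq; exists (x :: q).
by rewrite /simple_path q_uniq /= xM lastq eqxx -path_dpath_arcs.
Qed.

Lemma dpath_arcs_setX (W : {set T}) p : 1 < size p ->
  all (mem (setX W W)) (dpath_arcs p) = all (mem W) p.
Proof.
case: p => [|x [|z p]] //= _; rewrite -/(dpath_arcs (z :: p)) inE /= -andbA.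
congr andb; elim: p z => [|t p IH] z /=; first by rewrite andbT.
by rewrite -/(dpath_arcs (t :: p)) inE /= -andbA IH andbA andbb.
Qed.

Lemma all_dpath_closed S (P : {set T}) x p :
    (forall u v, (u, v) \in S -> u \in P -> v \in P) ->
    all (mem S) (dpath_arcs (x :: p)) -> x \in P ->
  all (mem P) (x :: p).
Proof.
move=> P_closed; elim: p x => [|z p IH] x /=; first by move=> _ ->.
by move=> /andP[xz zp] xP; rewrite xP; apply: IH zp (P_closed _ _ xz xP).
Qed.

End VertexSequences.

Section Flows.
Local Open Scope ring_scope.
Variable T : finType.
Implicit Types (x y v : T) (p : seq T) (a : T * T) (M X : {set T}).
Implicit Types (A P f g : {set T * T}).

(* A set of arcs is regarded as a 0/1 flow. *)
Definition arc_excess a v : int := (a.2 == v)%:Z - (a.1 == v)%:Z.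
Definition excess f v : int := \sum_(a in f) arc_excess a v.

Lemma excess0 v : excess set0 v = 0.
Proof. exact: big_set0. Qed.

Lemma excess_setID f g v :
  excess f v = excess (f :&: g) v + excess (f :\: g) v.
Proof. exact: big_setID. Qed.

Lemma excessD f g v : g \subset f ->
  excess (f :\: g) v = excess f v - excess g v.
Proof. by move=> gf; rewrite (excess_setID f g) (setIidPr gf) addrC addKr. Qed.

Lemma excessU f g v : [disjoint f & g] ->
  excess (f :|: g) v = excess f v + excess g v.
Proof.
move=> dfg; rewrite (excess_setID _ f) setUK setDUl setDv set0U.
by rewrite (setDidPl _) // disjoint_sym.
Qed.

Definition arc_rev a : T * T := (a.2, a.1).

Lemma arc_revK : involutive arc_rev.
Proof. by case. Qed.

Lemma excess_rev f v : excess (arc_rev @: f) v = - excess f v.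
Proof.
rewrite /excess big_imset => [|a b _ _ /(can_inj arc_revK)//].
by rewrite -sumrN; apply: eq_bigr => a _; rewrite /arc_excess opprB.
Qed.

Lemma excess_dpath_arcs x p v : uniq (x :: p) ->
  excess [set a in dpath_arcs (x :: p)] v = (last x p == v)%:Z - (x == v)%:Z.
Proof.
move=> xp_uniq.
have arcs_uniq : uniq (dpath_arcs (x :: p)) by apply: zip_uniql.
rewrite /excess (eq_bigl (mem (dpath_arcs (x :: p)))) => [|a]; last first.
  by rewrite inE.
rewrite -big_uniq //=; elim: p x {xp_uniq arcs_uniq} => [|z p IH] x /=.
  by rewrite big_nil subrr.
by rewrite big_cons IH /arc_excess addrC addrA subrK.
Qed.

Lemma excess_dpath_from_to M y p v : uniq p -> dpath_from_to M y p ->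
  v \notin M -> excess [set a in dpath_arcs p] v = (v == y)%:Z.
Proof.
case: p => [//|x p] p_uniq /= /andP[xM /eqP <-] vM.
have /negPf xv : x != v by apply: contraNneq vM => <-.
by rewrite excess_dpath_arcs // xv subr0 eq_sym.
Qed.

Definition entering A X : {set T * T} :=
  [set a in A | (a.1 \notin X) && (a.2 \in X)].

Lemma sum_excess f X :
  \sum_(v in X) excess f v = #|entering f X|%:Z - #|entering f (~: X)|%:Z.
Proof.
have count (b : pred (T * T)) :
    \sum_(a in f) (b a)%:Z = #|[set a in f | b a]|%:Z.
  rewrite -sum1_card -natz natr_sum big_mkcond [RHS]big_mkcond /=.
  by apply: eq_bigr => a _; rewrite inE; case: (a \in f); case: (b a).
rewrite exchange_big -!count -sumrB; apply: eq_bigr => a _ /=.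
have ends x : \sum_(v in X) (x == v)%:Z = (x \in X)%:Z.
  rewrite big_mkcond (bigD1 x) //= eqxx big1 => [|v /negPf vx].
    by rewrite addr0; case: (x \in X).
  by rewrite eq_sym vx if_same.
by rewrite sumrB !ends !inE; case: (a.1 \in X); case: (a.2 \in X).
Qed.

Definition separates M y X : bool := (y \in X) && [disjoint M & X].

Lemma simple_path_hits_cut A M y X p :
    separates M y X -> simple_path A M y p ->
  has (mem (entering A X)) (dpath_arcs p).
Proof.
case: p => [|x p] /andP[yX dMX] /and3P[//= _ /andP[xM /eqP lastp]].
have /negPf := disjointFr dMX xM; elim: p x lastp {xM} => [|z p IH] x /=.
  by move=> ->; rewrite yX.
move=> lastp xX /andP[xzA zp]; rewrite inE xzA xX /=.
by have [//|/negPf zX] := boolP (z \in X); apply: IH lastp zX zp.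
Qed.

Lemma simple_path_or_cut A M y :
  (exists p, simple_path A M y p) \/
  (exists2 X, separates M y X & entering A X = set0).
Proof.
pose e u v := (u, v) \in A; pose X := [set v | connect e v y].
have [dMX|] := boolP [disjoint M & X].
  right; exists X; first by rewrite /separates dMX inE connect0.
  apply/setP => -[u v]; rewrite !inE /=; apply/negP => /and3P[uvA /negP uX vX].
  by apply: uX; apply: connect_trans vX; apply: connect1.
move=> /pred0Pn[x /andP[/= xM]]; rewrite inE => /connectP[p xp yE].
left; apply: (@shorten_simple_path _ _ _ _ (x :: p)).
  by rewrite /= xM yE eqxx.
by rewrite -path_dpath_arcs.
Qed.

Definition flow M y (n : nat) f : Prop :=
  forall v, v \notin M -> excess f v = n%:Z *+ (v == y).

Lemma flow0 M y : flow M y 0 set0.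
Proof. by move=> v _; rewrite excess0 mul0rn. Qed.

Lemma flow_across M y n f X : flow M y n f -> separates M y X ->
  #|entering f X| = (n + #|entering f (~: X)|)%N.
Proof.
move=> fn /andP[yX dMX]; have := sum_excess f X.
rewrite (bigD1 y) //= big1 => [|v /andP[vX /negPf vy]]; last first.
  by rewrite fn ?vy // (disjointFl dMX vX).
by rewrite fn ?(disjointFl dMX yX) // eqxx; lia.
Qed.

Definition residual A f : {set T * T} := (A :\: f) :|: arc_rev @: f.

Lemma residual_augment A f P : f \subset A -> P \subset residual A f ->
  exists2 g : {set T * T}, g \subset A &
    forall v, excess g v = excess f v + excess P v.
Proof.
move=> fA PR; pose new := P :&: (A :\: f).
pose old := arc_rev @: (P :\: (A :\: f)).
have old_f : old \subset f.
  apply/subsetP => _ /imsetP[a /setDP[aP aAf] ->].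
  have := subsetP PR a aP; rewrite inE (negPf aAf) => /imsetP[b bf ->].
  by rewrite arc_revK.
have old_new : [disjoint f :\: old & new].
  by apply/pred0P => a; rewrite /= !inE; case: (a \in f); rewrite ?andbF.
exists ((f :\: old) :|: new) => [|v].
  rewrite subUset (subset_trans (subsetDl _ _) fA) /=.
  exact: subset_trans (subsetIr _ _) (subsetDl _ _).
rewrite excessU // excessD // excess_rev opprK.
by rewrite (excess_setID P (A :\: f)) addrAC addrA.
Qed.

Lemma residual_cut A f X : f \subset A -> entering (residual A f) X = set0 ->
  entering A X = entering f X /\ entering f (~: X) = set0.
Proof.
move=> fA /setP cutX; split; apply/setP => -[u v].
  have := cutX (u, v); rewrite !inE /=.
  have [/(subsetP fA)->//|uvf] := boolP ((u, v) \in f).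
  by case: (_ \in A).
have := cutX (v, u); rewrite !inE /= negbK => vu.
apply: contraFF vu => /and3P[uvf -> ->]; rewrite andbT orbC.
by rewrite -[(v, u)]/(arc_rev (u, v)) (mem_imset _ _ (can_inj arc_revK)) uvf.
Qed.

Lemma flow_or_cut A M y n :
  (exists2 f : {set T * T}, f \subset A & flow M y n f) \/
  (exists2 X, separates M y X & (#|entering A X| < n)%N).
Proof.
elim: n => [|n [[f fA fn]|[X MyX lt_n]]].
- by left; exists set0; [apply: sub0set|apply: flow0].
- have [[p /and3P[p_uniq Myp /allP pR]]|[X MyX]] :=
    simple_path_or_cut (residual A f) M y.
    have [|g gA gE] := @residual_augment A f [set a in dpath_arcs p] fA.
      by apply/subsetP => a; rewrite inE => /pR.
    left; exists g => // v vM.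
    by rewrite gE fn // (excess_dpath_from_to p_uniq Myp vM); case: eqP; lia.
  case/(residual_cut fA) => AX fX; right; exists X => //.
  by rewrite AX (flow_across fn MyX) fX cards0 addn0.
- by right; exists X => //; apply: ltnW.
Qed.

Definition disjoint_simple_paths A M y (n : nat) : Prop :=
  exists ps : seq (seq T),
    [/\ size ps = n,
        forall p, p \in ps -> simple_path A M y p
      & pairwise_disjoint (map (@dpath_arcs T) ps)].

Lemma flow_decomposition M y n f :
  flow M y n f -> disjoint_simple_paths f M y n.
Proof.
elim: n f => [|n IH] f fn; first by exists [::].
have [[p p_path]|[X MyX fX]] := simple_path_or_cut f M y; last first.
  by have := flow_across fn MyX; rewrite fX cards0.
have /and3P[p_uniq Myp /allP pf] := p_path.
have [v vM|ps [szps psf dps]] := IH (f :\: [set a in dpath_arcs p]).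
  rewrite excessD; last by apply/subsetP => a; rewrite inE => /pf.
  by rewrite fn // (excess_dpath_from_to p_uniq Myp vM); case: eqP; lia.
exists (p :: ps); split=> /=; first by rewrite szps.
  move=> q; rewrite inE => /predU1P[->//|/psf/and3P[q_uniq Myq]].
  by rewrite all_setD => /andP[qf _]; apply/and3P.
apply/andP; split=> //; apply/allP => _ /mapP[q /psf/and3P[_ _ qf] ->].
move: qf; rewrite all_setD => /andP[_]; apply: contra => /hasP[a aq ap].
by apply/hasP; exists a; rewrite //= inE.
Qed.

Lemma disjoint_simple_paths_or_cut A M y n :
  disjoint_simple_paths A M y n \/
  (exists2 X, separates M y X & (#|entering A X| < n)%N).
Proof.
have [[f fA /flow_decomposition[ps [szps psf dps]]]|] := flow_or_cut A M y n.
  left; exists ps; split=> // p /psf/and3P[p_uniq Myp /allP pf].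
  by apply/and3P; split=> //; apply/allP => a /pf/(subsetP fA).
by right.
Qed.

End Flows.

Section Menger.
Variable T : finType.
Implicit Types (D : digraph T) (M X : {set T}) (S : {set T * T}) (y : T).

Definition inner_arcs D : {set T * T} :=
  arcs D :&: setX (vertices D) (vertices D).

Lemma inner_arcs_remove_arcs D S :
  inner_arcs (remove_arcs D S) = inner_arcs D :\: S.
Proof. exact: setIDAC. Qed.

Lemma is_dpathE D p :
  is_dpath D p =
    [&& 1 < size p, uniq p & all (mem (inner_arcs D)) (dpath_arcs p)].
Proof.
rewrite /is_dpath; have [p1|//] := boolP (1 < size p).
do 2 congr (_ && _); rewrite -(dpath_arcs_setX _ p1) andbC.
have -> : sorted (fun u v => (u, v) \in arcs D) p =
    all (mem (arcs D)) (dpath_arcs p).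
  by case: p {p1} => [//|x p]; rewrite /= path_dpath_arcs.
by rewrite -all_predI; apply: eq_all => a; rewrite /= [RHS]inE.
Qed.

Lemma dpath_simple_path D M y p :
  is_dpath D p && dpath_from_to M y p = simple_path (inner_arcs D) (M :\ y) y p.
Proof.
rewrite is_dpathE /simple_path.
by have [/dpath_from_toD1->|] := boolP (uniq p); rewrite ?andbF // andbAC.
Qed.

Lemma is_dpath_remove_arcs D S p :
  is_dpath (remove_arcs D S) p = is_dpath D p && ~~ has (mem S) (dpath_arcs p).
Proof. by rewrite !is_dpathE inner_arcs_remove_arcs all_setD !andbA. Qed.

Lemma arc_disjoint_paths_MaxArcPaths D M y :
  arc_disjoint_paths D M y (MaxArcPaths D M y).
Proof. by rewrite /MaxArcPaths; case: ex_maxnP => n /asboolP. Qed.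

Lemma leq_MaxArcPaths D M y n :
  arc_disjoint_paths D M y n -> n <= MaxArcPaths D M y.
Proof.
by rewrite /MaxArcPaths; case: ex_maxnP => m _ m_max /asboolP; apply: m_max.
Qed.

Lemma arc_separator_ArcSepSize D M y :
  arc_separator_of_size D M y (ArcSepSize D M y).
Proof. by rewrite /ArcSepSize; case: ex_minnP => n /asboolP. Qed.

Lemma ArcSepSize_leq D M y S :
  is_arc_separator D M y S -> ArcSepSize D M y <= #|S|.
Proof.
rewrite /ArcSepSize; case: ex_minnP => n _ n_min sepS.
by apply: n_min; apply/asboolP; exists S.
Qed.

Lemma arc_separator_hits D M y S p : is_arc_separator D M y S ->
  is_dpath D p && dpath_from_to M y p -> has (mem S) (dpath_arcs p).
Proof.
move=> [_ nopath] /andP[pD Myp]; apply/negPn/negP => Sp; apply: nopath.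
by exists p; rewrite is_dpath_remove_arcs pD Sp.
Qed.

Lemma arc_separator_entering D M y X : separates (M :\ y) y X ->
  is_arc_separator D M y (entering (inner_arcs D) X).
Proof.
move=> MyX; split; first by apply/subsetP => a; rewrite !inE => /andP[/andP[]].
move=> [p]; rewrite is_dpath_remove_arcs -andbA [~~ _ && _]andbC andbA.
by rewrite dpath_simple_path => /andP[/(simple_path_hits_cut MyX)->].
Qed.

Lemma MaxArcPaths_leq_ArcSepSize D M y : MaxArcPaths D M y <= ArcSepSize D M y.
Proof.
have [ps [<- psD dps]] := arc_disjoint_paths_MaxArcPaths D M y.
have [S sepS <-] := arc_separator_ArcSepSize D M y.
rewrite -(size_map (@dpath_arcs T)); apply: pairwise_disjoint_hitting_size dps.
by move=> _ /mapP[p /psD pD ->]; apply: arc_separator_hits sepS pD.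
Qed.

Theorem arc_Menger D M y : MaxArcPaths D M y = ArcSepSize D M y.
Proof.
apply/eqP; rewrite eqn_leq MaxArcPaths_leq_ArcSepSize /=.
have [[ps [szps psD dps]]|[X /arc_separator_entering sepX]] :=
    disjoint_simple_paths_or_cut (inner_arcs D) (M :\ y) y (ArcSepSize D M y).
  apply: leq_MaxArcPaths; exists ps; split=> // p /psD.
  by rewrite dpath_simple_path.
by rewrite ltnNge ArcSepSize_leq.
Qed.

End Menger.

Section TwoCNF.
Variable V : finType.
Implicit Types (l u v : lit V) (p : seq (lit V)) (a : lit V * lit V).
Implicit Types (w : seq (entry V)) (L P : {set lit V}).
Implicit Types (S : {set lit V * lit V}) (F SC : {set {set lit V}}).

Lemma clause_disjoint_paths_MaxPaths F L l :
  clause_disjoint_paths F L l (MaxPaths F L l).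
Proof. by rewrite /MaxPaths; case: ex_maxnP => n /asboolP. Qed.

Lemma leq_MaxPaths F L l n :
  clause_disjoint_paths F L l n -> n <= MaxPaths F L l.
Proof.
by rewrite /MaxPaths; case: ex_maxnP => m _ m_max /asboolP; apply: m_max.
Qed.

Lemma separator_SepSize F L l : separator_of_size F L l (SepSize F L l).
Proof. by rewrite /SepSize; case: ex_minnP => n /asboolP. Qed.

Lemma SepSize_leq F L l SC : is_separator F L l SC -> SepSize F L l <= #|SC|.
Proof.
rewrite /SepSize; case: ex_minnP => n _ n_min sepSC.
by apply: n_min; apply/asboolP; exists SC.
Qed.

Lemma is_walk_setD F SC w :
  is_walk (F :\: SC) w = is_walk F w && ~~ has (mem SC) (walk_clauses w).
Proof.
have clausesE G : all (fun e => entry_clause e \in G) w =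
    all (mem G) (walk_clauses w) by rewrite all_map.
rewrite /is_walk !clausesE all_setD -!andbA.
by do 2 congr (_ && _); rewrite andbC.
Qed.

Lemma separator_hits F L l SC w : is_separator F L l SC ->
  is_path F w && walk_from_to L l w -> has (mem SC) (walk_clauses w).
Proof.
move=> [_ nopath] /andP[/andP[wF w_uniq] Llw]; apply/negPn/negP => SCw.
by apply: nopath; exists w; rewrite /is_path is_walk_setD wF SCw w_uniq.
Qed.

Lemma MaxPaths_leq_SepSize F L l : MaxPaths F L l <= SepSize F L l.
Proof.
have [ws [<- wsF dws]] := clause_disjoint_paths_MaxPaths F L l.
have [SC sepSC <-] := separator_SepSize F L l.
rewrite -(size_map (@walk_clauses V)).
apply: pairwise_disjoint_hitting_size dws => _ /mapP[w /wsF wF ->].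
exact: separator_hits sepSC wF.
Qed.

Lemma negK : involutive (@neg V).
Proof. by case=> x b; rewrite /neg /= negbK. Qed.

Lemma negsK : involutive (@negs V).
Proof. by move=> L; rewrite /negs -imset_comp (eq_imset _ negK) imset_id. Qed.

Lemma mem_negs L l : (l \in negs L) = (neg l \in L).
Proof. by rewrite -{1}[l]negK mem_imset //; apply: can_inj negK. Qed.

Definition arc_clause a : {set lit V} := [set neg a.1; a.2].
Definition arc_entry a : entry V := (neg a.1, a.2).
Definition walk_along p : seq (entry V) := map arc_entry (dpath_arcs p).

Lemma arcs_implication_graph F :
  arcs (implication_graph F) = arc_clause @^-1: F.
Proof. by apply/setP => a; rewrite !inE. Qed.

Lemma inner_arcs_implication_graph F :
  inner_arcs (implication_graph F) = arcs (implication_graph F).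
Proof.
apply/setIidPl/subsetP => -[u v]; rewrite !inE /= => uvF.
have occurs l : l \in [set neg u; v] -> var l \in cnf_vars F.
  by move=> l_uv; apply: imset_f; apply/bigcupP; exists [set neg u; v].
by rewrite -[var u]/(var (neg u)) !occurs ?set21 ?set22.
Qed.

Lemma walk_clauses_along p :
  walk_clauses (walk_along p) = map arc_clause (dpath_arcs p).
Proof. by rewrite /walk_clauses -map_comp. Qed.

Lemma is_walk_along F p : 1 < size p -> is_walk F (walk_along p) =
  all (mem (arcs (implication_graph F))) (dpath_arcs p).
Proof.
move=> p1; have chained : sorted (fun e e' => e.2 == neg e'.1) (walk_along p).
  case: p {p1} => [//|x [//|z p]] /=; elim: p x z => [//|t p IH] x z.
  by rewrite /= negK eqxx /=; apply: IH.
have walk_nonempty : walk_along p != [::] by case: p p1 {chained} => [//|x []].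
rewrite /is_walk walk_nonempty chained andbT all_map arcs_implication_graph.
by apply: eq_all => a; rewrite /= inE.
Qed.

Lemma walk_from_to_along L l p : 1 < size p ->
  walk_from_to L l (walk_along p) = dpath_from_to (negs L) l p.
Proof.
case: p => [//|x [//|z p]] _; rewrite /= mem_negs.
suff -> : (last (arc_entry (x, z)) (walk_along (z :: p))).2 = last z p by [].
by elim: p x z => [//|t p IH] x z; apply: IH.
Qed.

Lemma walk_along_surj F w :
  is_walk F w -> exists2 p, 1 < size p & w = walk_along p.
Proof.
have entryK e : arc_entry (neg e.1, e.2) = e.
  by case: e => k l; rewrite /arc_entry negK.
case: w => [//|e w] /and3P[_ _ chain_w].
suff wE : e :: w = walk_along (neg e.1 :: e.2 :: map snd w).
  by exists (neg e.1 :: e.2 :: map snd w).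
elim: w e chain_w => [|e' w IH] e; first by rewrite /walk_along /= entryK.
move=> /= /andP[/eqP ee' chain_w].
by rewrite {1}(IH e' chain_w) -ee' /walk_along /= entryK.
Qed.

Lemma arc_separator_separator F L l S : l \notin negs L ->
    is_arc_separator (implication_graph F) (negs L) l S ->
  is_separator F L l (arc_clause @: S).
Proof.
move=> lL [SD nopath]; split.
  rewrite arcs_implication_graph in SD.
  by apply/subsetP => _ /imsetP[a /(subsetP SD) aF ->]; rewrite inE in aF.
move=> [w /andP[/andP[w_walk _] Llw]].
have [p p1 wE] := walk_along_surj w_walk.
move: w_walk Llw; rewrite {w}wE is_walk_along // walk_from_to_along //.
move=> pD Llp; have [q] : exists q,
    simple_path (arcs (implication_graph F) :\: S) (negs L) l q.
  apply: shorten_simple_path Llp _; apply: sub_all pD => a.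
  rewrite !arcs_implication_graph /= !inE => /andP[aS ->].
  by rewrite andbT; apply: contra aS; apply: imset_f.
rewrite -inner_arcs_implication_graph -inner_arcs_remove_arcs.
have {1}<- : negs L :\ l = negs L.
  by apply/setDidPl; rewrite disjoint_sym disjoints1.
by rewrite -dpath_simple_path => q_path; apply: nopath; exists q.
Qed.

Lemma SepSize_leq_ArcSepSize F L l : l \notin negs L ->
  SepSize F L l <= ArcSepSize (implication_graph F) (negs L) l.
Proof.
move=> lL; have [S /(arc_separator_separator lL) sepS <-] :=
  arc_separator_ArcSepSize (implication_graph F) (negs L) l.
exact: leq_trans (SepSize_leq sepS) (leq_imset_card _ _).
Qed.

Lemma satisfying_neg F P l : satisfying F P -> var l \in cnf_vars F ->
  (neg l \in P) = (l \notin P).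
Proof.
move=> [nc <- _] /imsetP[k kP lk]; apply/idP/idP => [|lP].
  by apply: contraL => /nc.
suff -> : neg l = k by [].
case: l k lk kP lP => [x b] [_ c] /= <-.
by case: b c => -[] // ->.
Qed.

Lemma satisfying_arc F P u v : satisfying F P ->
  (u, v) \in arcs (implication_graph F) -> u \in P -> v \in P.
Proof.
move=> [nc _ sat]; rewrite inE => uvF /nc nuP.
by have [l /set2P[->|->]] := sat _ uvF; rewrite ?(negPf nuP).
Qed.

Lemma arc_clause_inj P : noncontradictory P ->
  {in setX P P &, injective arc_clause}.
Proof.
move=> nc [a b] [c d] /setXP[aP bP] /setXP[cP dP] /= eq_clause.
have naP := nc _ aP; have ncP := nc _ cP.
have /set2P[bc|->] : b \in arc_clause (c, d) by rewrite -eq_clause set22.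
  by rewrite -bc bP in ncP.
have /set2P[/= /(can_inj negK)->//|/= nad] : neg a \in arc_clause (c, d).
  by rewrite -eq_clause set21.
by rewrite nad dP in naP.
Qed.

Section Satisfied.
Variables (F : {set {set lit V}}) (L P : {set lit V}) (l : lit V).
Hypotheses (satP : satisfying F P) (dPL : [disjoint P & L]).

Let D := implication_graph F.

Lemma dpath_arcs_satisfied p : is_dpath D p && dpath_from_to (negs L) l p ->
  all (mem (setX P P)) (dpath_arcs p).
Proof.
move=> /andP[pD Llp]; have /and4P[_ _ p_vertices _] := pD.
move: pD; rewrite is_dpathE inner_arcs_implication_graph.
move=> /and3P[p1 _ pD]; rewrite dpath_arcs_setX //.
case: p Llp p_vertices pD {p1} => [//|x p] /andP[xL _] /andP[x_vertex _] pD.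
apply: all_dpath_closed pD _ => [u v|]; first exact: satisfying_arc.
rewrite mem_negs in xL; rewrite /= inE in x_vertex.
by rewrite -[x \in P]negbK -(satisfying_neg satP x_vertex) (disjointFl dPL xL).
Qed.

Lemma is_path_walk_along p : is_dpath D p && dpath_from_to (negs L) l p ->
  is_path F (walk_along p) && walk_from_to L l (walk_along p).
Proof.
move=> pD; have /allP pP := dpath_arcs_satisfied pD; have [nc _ _] := satP.
move: pD; rewrite is_dpathE inner_arcs_implication_graph.
move=> /andP[/and3P[p1 p_uniq pD] Llp].
rewrite /is_path is_walk_along // pD walk_from_to_along // Llp andbT.
rewrite walk_clauses_along map_inj_in_uniq; first exact: zip_uniql.
by move=> a b /pP aP /pP bP; apply: arc_clause_inj nc _ _ aP bP.
Qed.

Lemma MaxArcPaths_leq_MaxPaths : MaxArcPaths D (negs L) l <= MaxPaths F L l.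
Proof.
have [ps [<- psD dps]] := arc_disjoint_paths_MaxArcPaths D (negs L) l.
apply: leq_MaxPaths; exists (map walk_along ps); split; first exact: size_map.
  by move=> _ /mapP[p /psD pD ->]; apply: is_path_walk_along.
have [nc _ _] := satP; rewrite -map_comp (eq_map walk_clauses_along) map_comp.
apply: pairwise_disjoint_map (arc_clause_inj nc) _ dps.
by move=> _ /mapP[p /psD/dpath_arcs_satisfied/allP pP ->].
Qed.

End Satisfied.

End TwoCNF.

Theorem theorem2 (V : finType) (F : {set {set lit V}}) (L : {set lit V})
    (ly : lit V)
    (F_2cnf : is_2cnf F)
    (F_sat : SWRT F (negs L))
    (ly_L : var ly \notin lit_vars L) :
  let D := implication_graph F in
  [/\ MaxPaths F L ly = MaxArcPaths D (negs L) ly,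
      SepSize F L ly = ArcSepSize D (negs L) ly
    & MaxPaths F L ly = SepSize F L ly].
Proof.
move=> D; have [P satP] := F_sat.
rewrite negsK => /eqP; rewrite setI_eq0 => dPL.
have ly_negsL : ly \notin negs L.
  by apply: contra ly_L => /imsetP[l lL ->]; apply/imsetP; exists l.
have := MaxArcPaths_leq_MaxPaths ly satP dPL.
have := MaxPaths_leq_SepSize F L ly.
have := SepSize_leq_ArcSepSize F ly_negsL.
have := arc_Menger D (negs L) ly.
by rewrite -/D => *; split; lia.
Qed.
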